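(* For dynamic and binary (additive, not necessarily symmetric) valuations, there is no algorithm which is EF1-over-rounds. That is, there exist finite sets $N,M$ with $|N|=|M|$, a number $a\in[0,1)$, and dynamic valuations with $v_i^t(j)\in\{a,1\}$ for all $t\ge1$ and all $i,j$ on opposite sides, such that no sequence $x^1,x^2,\dots$ of perfect matchings between $N$ and $M$ has the property that the cumulative matching $X^t$ is EF1 for every $t\ge 0$.
   Context: Setting. $N$ and $M$ are disjoint finite sets of agents (the two sides of the market), $|N|=|M|$. At each time step $t=1,2,\dots$ a perfect matching $x^t$ between $N$ and $M$ is chosen; $x^t_i$ denotes the agent matched to $i$ at time $t$. The cumulative matching $X^t$ assigns to each agent $i$ the multiset $X_i^t$ of matches received at times $1,\dots,t$ (each match remembered with its time); $X_i^0=\emptyset$. Dynamic additive valuations. Each agent $i$ has at each time $t$ a value $v_i^t(j)$ for each agent $j$ on the opposite side. For $i,j$ on the same side (possibly $i=j$), $v_i(X_j^t)=\sum_{t'=1}^{t} v_i^{t'}(x_j^{t'})$. Envy and EF1. For $i,j$ on the same side, $i$ envies $j$ under $X$ if $v_i(X_i)<v_i(X_j)$. $X$ is EF1 if whenever $i$ envies $j$ there is a single match $k\in X_j$ such that $v_i(X_i)\ge v_i(X_j\setminus\{k\})$ (one occurrence of $k$ is removed, i.e. the match made at one particular time, so the value drops by $i$'s value for that match at that time). An algorithm is EF1-over-rounds if for every instance it produces a sequence of perfect matchings $x^1,x^2,\dots$ with $X^t$ EF1 for all $t\ge0$. *)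

(* Defs.v *)
From HB Require Import structures.
From mathcomp Require Import all_boot all_order all_algebra.
From mathcomp Require Import reals.
Set Implicit Arguments.
Unset Strict Implicit.
Unset Printing Implicit Defensive.
Import Order.TTheory GRing.Theory Num.Theory.
Local Open Scope ring_scope.

(* The two sides are separate types, hence automatically disjoint. *)
Record perfect_matching (N M : finType) := PerfectMatching {
  partnerN : N -> M;
  partnerM : M -> N;
  partnerNK : cancel partnerN partnerM;
  partnerMK : cancel partnerM partnerN
}.

(* In this section S is one side of the market and T the opposite one; [v t i k]
   is the value of i for k at time t. Time steps start at 1: the values of
   time-indexed functions at 0 are never used. *)
Section OneSide.
Variables (R : realType) (S T : finType).
Implicit Types (v : nat -> S -> T -> R) (y : nat -> S -> T).

(* The multiset X_i^t; each match is recorded as a pair (time, partner), so that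
   removing one pair removes exactly one occurrence of the partner. *)
Definition bundle y (t : nat) (i : S) : seq (nat * T) :=
  [seq (s, y s i) | s <- iota 1 t].

Definition bundle_value v (i : S) (B : seq (nat * T)) : R :=
  \sum_(m <- B) v m.1 i m.2.

Definition envies v (X : S -> seq (nat * T)) (i j : S) : Prop :=
  bundle_value v i (X i) < bundle_value v i (X j).

Definition EF1_side v (X : S -> seq (nat * T)) : Prop :=
  forall i j : S, envies v X i j ->
    exists2 k, k \in X j &
      bundle_value v i (X i) >= bundle_value v i (rem k (X j)).

Definition binary_valuation (a : R) v : Prop :=
  forall t i k, (1 <= t)%N -> v t i k = a \/ v t i k = 1.

End OneSide.

Section Market.
Variables (R : realType) (N M : finType).
Variables (vN : nat -> N -> M -> R) (vM : nat -> M -> N -> R).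

Definition EF1 (x : nat -> perfect_matching N M) (t : nat) : Prop :=
  EF1_side vN (bundle (fun s => partnerN (x s)) t) /\
  EF1_side vM (bundle (fun s => partnerM (x s)) t).

Definition EF1_over_rounds (x : nat -> perfect_matching N M) : Prop :=
  forall t : nat, EF1 x t.

End Market.

(* Main.v *)
Require Import Defs.
From mathcomp Require Import all_boot all_order all_algebra.
From mathcomp Require Import reals.
Set Implicit Arguments.
Unset Strict Implicit.
Unset Printing Implicit Defensive.
Import Order.TTheory GRing.Theory Num.Theory.
Local Open Scope ring_scope.

(** Two agents per side, valuations in {0, 1}, two rounds. Index both sides by
    [bool], so that a perfect matching is [addb b] for some [b]. In round 1 each
    agent of [N] likes only the partner with the other index and each agent of [M]
    only the one with its own index, so one whole side gets value 0 in round 1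
    while valuing its rival's match at 1. In round 2 everybody likes only the
    partner [true]; the agent of the losing side that is matched to [false] then
    has total value 0 and values its rival's two matches at 1 each. *)

Lemma EF1_side_two_rounds (R : realType) (S T : finType) (v : nat -> S -> T -> R)
    (y : nat -> S -> T) (i j : S) :
  EF1_side v (bundle y 2) ->
  v 1%N i (y 1%N i) = 0 -> v 2%N i (y 2%N i) = 0 ->
  v 1%N i (y 1%N j) = 1 -> v 2%N i (y 2%N j) = 1 -> False.
Proof.
move=> ef1 vi1 vi2 vj1 vj2.
have Xi0 : bundle_value v i (bundle y 2 i) = 0.
  by rewrite /bundle_value /= !big_cons big_nil /= vi1 vi2 !addr0.
have [|k kXj] := ef1 i j.
  rewrite /envies Xi0 /bundle_value /= !big_cons big_nil /= vj1 vj2 addr0.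
  exact: addr_gt0.
have vk1 : v k.1 i k.2 = 1.
  by move: kXj; rewrite !inE => /orP[] /eqP ->.
have Xj2 : bundle_value v i (bundle y 2 j) = 1 + 1.
  by rewrite /bundle_value /= !big_cons big_nil /= vj1 vj2 addr0.
(* Whichever [k] is removed is worth 1 to [i]; cancelling it leaves 1, still above 0. *)
move: Xj2; rewrite /bundle_value (perm_big _ (perm_to_rem kXj)) big_cons /= vk1.
by move=> /addrI ->; rewrite [X in _ <= X]Xi0 ler10.
Qed.

(** Injectivity on [bool] makes the image of [false] determine the map; as [addb b] is an
    involution, the inverse has the same [b]. *)
Lemma perfect_matching_bool (m : perfect_matching bool bool) :
  exists b, partnerN m =1 addb b /\ partnerM m =1 addb b.
Proof.
case: m => f g fK gK /=; exists (f false).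
have fE : f =1 addb (f false).
  case; last by rewrite addbF.
  have : f true != f false by rewrite (inj_eq (can_inj fK)).
  by case: (f true); case: (f false).
by split=> // k; apply: (can_inj fK); rewrite gK fE addKb.
Qed.

Theorem theorem4p1 (R : realType) :
  exists (N M : finType) (a : R)
         (vN : nat -> N -> M -> R) (vM : nat -> M -> N -> R),
    [/\ #|N| = #|M|,
        0 <= a < 1,
        binary_valuation a vN,
        binary_valuation a vM
      & ~ exists x : nat -> perfect_matching N M, EF1_over_rounds vN vM x].
Proof.
exists bool, bool, 0.
exists (fun t i k => (if t == 1%N then i != k else k)%:R).
exists (fun t i k => (if t == 1%N then i == k else k)%:R).
split=> //.
- by rewrite lexx ltr01.
- by move=> t i k _; case: (if _ then _ else _); [right | left].
- by move=> t i k _; case: (if _ then _ else _); [right | left].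
case=> x /(_ 2%N) [efN efM].
have [b1 [xN1 xM1]] := perfect_matching_bool (x 1%N).
have [b2 [xN2 xM2]] := perfect_matching_bool (x 2%N).
(* The side losing round 1 is [M] if [b1] is [true], else [N]. On either side, agent [b2] gets
   [false] in round 2, since [addb b2 b2 = false]. *)
case: b1 xN1 xM1 => xN1 xM1.
- by apply: (EF1_side_two_rounds (i := b2) (j := ~~ b2) efM) => /=;
    rewrite ?xM1 ?xM2; case: (b2).
- by apply: (EF1_side_two_rounds (i := b2) (j := ~~ b2) efN) => /=;
    rewrite ?xN1 ?xN2; case: (b2).
Qed.
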